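(* Let $A \in (0,\infty)^{N \times N}$ be a Hermitian matrix that is $3$-PMP, let $\pi = \pi^{\{1\}}(A) = \{I_1,\ldots,I_m\}$, and let $\pi' = \{I'_1,\ldots,I'_{m'}\}$ be any partition of $\{1,\ldots,N\}$ refined by $\pi$ (that is, $\pi$ is a refinement of $\pi'$). Fix real powers $n_1 < \cdots < n_N$. Then the following four spaces are equal. (1) The simultaneous kernel of $A^{\circ n_j}$ for $j = 1,\ldots,N$. (2) The simultaneous kernel of $A^{\circ \alpha}$ for all $\alpha \in \mathbb{R}$. (3) The simultaneous kernel of the block-diagonal matrices $\operatorname{diag} A_{\pi'}^{\circ \alpha} := \bigoplus_{j=1}^{m'} A^{\circ\alpha}_{I'_j \times I'_j}$ for all $\alpha \in \mathbb{R}$. (4) The kernel of the matrix $J_\pi := \bigoplus_{j=1}^m \mathbf{1}_{I_j \times I_j}$. The same holds when the Hermitian $3$-PMP matrix $A$ has non-negative entries with at least one zero entry, as long as $n_1 = 0$ and $\alpha$ is taken to range over the non-negative reals in (2) and (3). These equalities of kernels need not hold for matrices that are not $3$-PMP: they can fail if the $3$-PMP hypothesis is dropped.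
   Context: A complex Hermitian matrix is $k$-PMP if every $l \times l$ principal minor is non-negative for all $l \in \{1,\ldots,k\}$. For $A \in \mathbb{C}^{N \times N}$, $\pi^{\{1\}}(A)$ is the unique coarsest partition $\{I_1,\ldots,I_m\}$ of $\{1,\ldots,N\}$ such that $A$ is constant on each block $I_i \times I_j$. $A^{\circ\alpha}$ is the matrix obtained from $A$ by taking the $\alpha$th power of each entry, with the convention $0^0 := 1$. $A_{I \times I}$ is the principal submatrix indexed by $I$; the direct sums are $N \times N$ block-diagonal matrices with diagonal blocks in positions $I'_j \times I'_j$ (respectively $I_j\times I_j$) and zeros elsewhere; $\mathbf{1}_{I \times I}$ has all entries $1$ on $I \times I$. *)

(* Defs.v *)
From HB Require Import structures.
From mathcomp Require Import all_boot all_order all_algebra.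
From mathcomp Require Import sesquilinear complex.
From mathcomp Require Import all_classical all_reals all_analysis.

Set Implicit Arguments.
Unset Strict Implicit.
Unset Printing Implicit Defensive.

Import Order.TTheory GRing.Theory Num.Theory.

Local Open Scope classical_set_scope.
Local Open Scope ring_scope.

Definition complexify (R : realType) (m n : nat) (A : 'M[R]_(m, n)) :
  'M[R[i]]_(m, n) := map_mx (real_complex R) A.

Definition principal_submx (C : Type) (N : nat) (A : 'M[C]_N)
    (I : {set 'I_N}) : 'M[C]_#|I| :=
  mxsub (@enum_val _ (mem I)) (@enum_val _ (mem I)) A.

(* The order on R[i] is the partial one: 0 <= z means that z is real and
   nonnegative, as principal minors of Hermitian matrices are real. *)
Definition PMP (R : realType) (k N : nat) (A : 'M[R[i]]_N) : Prop :=
  forall l : nat, (1 <= l <= k)%N ->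
  forall I : {set 'I_N}, #|I| = l -> 0 <= \det (principal_submx A I).

Definition refines (T : finType) (P Q : {set {set T}}) : Prop :=
  forall I, I \in P -> exists2 J, J \in Q & I \subset J.

Definition block_constant (C : Type) (N : nat) (A : 'M[C]_N)
    (P : {set {set 'I_N}}) : Prop :=
  forall I J, I \in P -> J \in P ->
  forall i i' j j', i \in I -> i' \in I -> j \in J -> j' \in J ->
  A i j = A i' j'.

(* P = pi^{1}(A); existence and uniqueness are proved below. *)
Definition is_pi1 (C : Type) (N : nat) (A : 'M[C]_N)
    (P : {set {set 'I_N}}) : Prop :=
  [/\ finset.partition P [set: 'I_N]%SET, block_constant A P &
      forall Q : {set {set 'I_N}}, finset.partition Q [set: 'I_N]%SET ->
        block_constant A Q -> refines Q P].

(* powR satisfies 0 `^ 0 = 1, and 0 `^ a = 0 for a <> 0. *)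
Definition hadamard_pow (R : realType) (m n : nat) (A : 'M[R]_(m, n)) (a : R) :
  'M[R]_(m, n) := map_mx (fun x => x `^ a) A.

(* The N x N matrix with diagonal blocks A_{I x I}, I in P, placed in
   positions I x I, and zeros elsewhere. *)
Definition block_diag (R : nzRingType) (N : nat) (P : {set {set 'I_N}})
    (A : 'M[R]_N) : 'M[R]_N :=
  \matrix_(i, j)
    if [exists I in P, (i \in I) && (j \in I)] then A i j else 0.

(* The kernel in C^N of a real matrix. *)
Definition kernel (R : realType) (N : nat) (A : 'M[R]_N) : set 'cV[R[i]]_N :=
  [set x | complexify A *m x = 0].

Definition ker_powers (R : realType) (N : nat) (A : 'M[R]_N)
    (n : 'I_N -> R) : set 'cV[R[i]]_N :=
  \bigcap_(j in [set: 'I_N]) kernel (hadamard_pow A (n j)).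

Definition ker_all_powers (R : realType) (D : set R) (N : nat)
    (A : 'M[R]_N) : set 'cV[R[i]]_N :=
  \bigcap_(a in D) kernel (hadamard_pow A a).

Definition ker_block_powers (R : realType) (D : set R) (N : nat)
    (A : 'M[R]_N) (P : {set {set 'I_N}}) : set 'cV[R[i]]_N :=
  \bigcap_(a in D) kernel (block_diag P (hadamard_pow A a)).

Definition Jmx (R : realType) (N : nat) (P : {set {set 'I_N}}) : 'M[R]_N :=
  block_diag P (const_mx 1).

Definition four_kernels_equal (R : realType) (D : set R) (N : nat)
    (A : 'M[R]_N) (n : 'I_N -> R) (P P' : {set {set 'I_N}}) : Prop :=
  [/\ ker_powers A n = ker_all_powers D A,
      ker_all_powers D A = ker_block_powers D A P' &
      ker_block_powers D A P' = kernel (Jmx R P)].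

Lemma is_pi1_unique (C : Type) (N : nat) (A : 'M[C]_N)
  (P Q : {set {set 'I_N}}) : is_pi1 A P -> is_pi1 A Q -> P = Q.
Proof.
suff sub P0 Q0 : is_pi1 A P0 -> is_pi1 A Q0 -> P0 \subset Q0.
  by move=> hP hQ; apply/eqP; rewrite finset.eqEsubset !sub.
move=> [pP cP mP] [pQ cQ mQ]; apply/fintype.subsetP => I IP.
have [J JQ IJ] := mQ _ pP cP _ IP; have [K KP JK] := mP _ pQ cQ _ JQ.
have /and3P[_ tP nP] := pP.
have I0 : I != finset.set0 by apply: contraNneq nP => <-.
have [x xI] := finset.set0Pn _ I0.
have xK : x \in K by apply: (fintype.subsetP JK); apply: (fintype.subsetP IJ).
have IK : I = K by rewrite -(def_pblock tP IP xI) (def_pblock tP KP xK).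
suff -> : I = J by [].
by apply/eqP; rewrite finset.eqEsubset IJ IK.
Qed.

Lemma is_pi1_exists (C : eqType) (N : nat) (A : 'M[C]_N) :
  exists P, is_pi1 A P.
Proof.
pose f i := (row i A, col i A).
pose P := preim_partition f [set: 'I_N]%SET.
have eqr : {in [set: 'I_N]%SET & &, equivalence_rel (fun i j => f i == f j)}.
  by split=> // /eqP->.
have pP : finset.partition P [set: 'I_N]%SET by apply: preim_partitionP.
have /and3P[_ tP _] := pP.
have blk I i i' : I \in P -> i \in I -> i' \in I -> f i = f i'.
  move=> IP iI i'I; apply/eqP.
  rewrite -(pblock_equivalence_partition eqr) ?inE //.
  by rewrite -[equivalence_partition _ _]/P (def_pblock tP IP iI).
exists P; split=> // [I J IP JP i i' j j' iI i'I jJ j'J|Q pQ cQ I IQ].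
  have [/rowP/(_ j) + _] := blk _ _ _ IP iI i'I.
  have [_ /colP/(_ i')] := blk _ _ _ JP jJ j'J.
  by rewrite !mxE => -> ->.
have /and3P[/eqP covQ tQ nQ] := pQ.
have I0 : I != finset.set0 by apply: contraNneq nQ => <-.
have [x xI] := finset.set0Pn _ I0.
exists (finset.pblock P x); first by rewrite pblock_mem // (finset.cover_partition pP) inE.
apply/fintype.subsetP => y yI.
rewrite (pblock_equivalence_partition eqr) ?inE //; apply/eqP.
have inQ j : j \in finset.pblock Q j by rewrite mem_pblock covQ inE.
have Qb j : finset.pblock Q j \in Q by rewrite pblock_mem // covQ inE.
by congr pair; apply/matrixP=> u v; rewrite !mxE;
  [apply: (cQ I (finset.pblock Q v)) | apply: (cQ (finset.pblock Q u) I)].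
Qed.

(* Main.v *)
Require Import Defs.
From mathcomp Require Import all_boot all_order all_algebra.
From mathcomp Require Import sesquilinear complex.
From mathcomp Require Import all_classical all_reals all_analysis.
From mathcomp Require Import ring.
Import Order.TTheory GRing.Theory Num.Theory.
Set Implicit Arguments.
Unset Strict Implicit.
Local Open Scope classical_set_scope.
Local Open Scope ring_scope.

(** Every one of the four spaces is the space of vectors whose entries sum to
zero over each class of equal rows of [A]; these classes are the blocks of
pi because [A] is symmetric. Since the matrices are real, a complex vector
lies in a kernel exactly when its real and imaginary parts do, so it suffices
to argue with real vectors [x].

One inclusion is immediate: the entry [A i j], and the fact that [j]
lies in the same block of pi' as [i], depend on [j] only through its class,
so a vector with zero class sums is killed by every entrywise power, whether
or not it is cut down to the blocks of pi' ([class_sums_masked_power]).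

For the converse, fix a row [i]. Grouping its entries by value turns the
[N] equations for the powers [n_1 < ... < n_N] into an exponential sum
[\sum_v c_v v ^ t] that vanishes at [N] points [t] and has at most [N] terms,
[c_v] being the sum of [x] over the level set of [v] in the row. By Rolle's
theorem a nonzero exponential sum has fewer real zeros than terms
([expsum_eq0]), so the sum of [x] over every level set vanishes. When the row
has zero entries there is one positive value less, and the exponents other than
[n_1 = 0] take care of the positive values; the power [n_1 = 0] then gives
the level set of zero ([power_sums_fibers_eq0]).

It remains to pass from level sets to classes, and this is where the minors
enter. Consider the level set [{j | A i j = A i i}]. The 2 x 2 minors force
[A j j >= A i i] on it, and the 3 x 3 minors force row [j] to equal row [i]
when [A j j = A i i] ([PMP3_row_eq]). The level set is therefore the class of
[i] together with classes of strictly larger diagonal entry, and the class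
sums vanish by induction on decreasing diagonal entry
([row_class_sums_eq0]). The same argument runs inside a single block of pi',
which gives the block-diagonal version.

Without the minors the last step breaks down: there is a symmetric two-valued
4 x 4 matrix with distinct rows, every level set of which meets [{0, 1}] and
[{2, 3}] equally often, so that [(1, 1, -1, -1)] is killed by all powers
although every class is a singleton. That this matrix violates the minor
condition follows from the equality of the kernels under that condition. *)

(** * Zeros of exponential sums *)

(** Rolle's theorem between consecutive zeros; the list of zeros is given with
its first element apart so that the induction can insert the new zero between
[a] and the next one. *)
Lemma rolle_path (R : realType) (f f' : R -> R) (a : R) (z : seq R) :
  (forall t, is_derive t (1 : R) f (f' t)) -> path <%R a z ->
  (forall t, t \in a :: z -> f t = 0) ->
  exists z', [/\ size z' = size z, path <%R a z' & forall t, t \in z' -> f' t = 0].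
Proof.
move=> df; elim: z a => [|b z IH] a; first by move=> _ _; exists [::].
move=> /= /andP[ab pz] f0.
have [|z' [sz' pz' f'0]] := IH b pz; first by move=> t tz; apply: f0; rewrite inE tz orbT.
have [|||c] := @Rolle R f a b ab.
- by move=> t _; case: (df t).
- apply: derivable_within_continuous => t _; by case: (df t).
- by rewrite !f0 // !inE eqxx ?orbT.
rewrite in_itv /= => /andP[ac cb] dc.
exists (c :: z'); split; first by rewrite /= sz'.
  by rewrite /= ac; apply: unstable.path_lt_head pz'.
move=> t; rewrite inE => /predU1P[->|/f'0//].
by rewrite -(@derive_val _ _ _ _ _ _ _ (df c)) (@derive_val _ _ _ _ _ _ _ dc).
Qed.

Lemma is_derive_expsum (R : realType) (s : seq R) (c m : R -> R) (t : R) :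
  is_derive t (1 : R) (fun t => \sum_(l <- s) c l * expR (m l * t))
    (\sum_(l <- s) c l * m l * expR (m l * t)).
Proof.
elim: s => [|l s IH].
  under eq_fun do rewrite big_nil.
  by rewrite big_nil; apply: is_derive_cst.
under eq_fun do rewrite big_cons.
rewrite big_cons; apply: is_deriveD.
apply: is_derive_eq; rewrite /GRing.scale /=; ring.
Qed.

(** Dividing by [expR (a * t)], with [a] one of the exponents, and
differentiating removes one term and, by Rolle, costs at most one zero. *)
Lemma expsum_eq0 (R : realType) (s z : seq R) (c : R -> R) :
  uniq s -> sorted <%R z -> (size s <= size z)%N ->
  (forall t, t \in z -> \sum_(l <- s) c l * expR (l * t) = 0) ->
  forall l, l \in s -> c l = 0.
Proof.
elim: s z c => [//|a s IH] [//|t0 z] c /= /andP[aNs us] pz szs g0.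
pose h t := \sum_(l <- a :: s) c l * expR ((l - a) * t).
have hE t : h t = expR (- a * t) * \sum_(l <- a :: s) c l * expR (l * t).
  by rewrite big_distrr; apply: eq_bigr => l _ /=; rewrite mulrBl expRD mulNr; ring.
have [|z' [sz' pz' h'0]] := rolle_path (is_derive_expsum (a :: s) c (fun l => l - a)) pz.
  by move=> t tz; rewrite -/(h t) hE g0 // mulr0.
have cs l : l \in s -> c l = 0.
  move=> ls; have la : l - a != 0 by rewrite subr_eq0; apply: contraNneq aNs => <-.
  apply: (mulIf la); rewrite mul0r.
  apply: (IH z' (fun l => c l * (l - a))) => //; rewrite ?sz' //; first exact: path_sorted pz'.
  move=> t tz; have := h'0 t tz; rewrite big_cons subrr mulr0 mul0r add0r => e0.
  apply: (mulfI (lt0r_neq0 (expR_gt0 (- a * t)))).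
  rewrite mulr0 -[RHS]e0 big_distrr; apply: eq_bigr => k _ /=.
  by rewrite (mulrBl t k a) expRD mulNr; ring.
move=> l; rewrite inE => /predU1P[->|/cs//].
have := g0 t0; rewrite inE eqxx => /(_ isT); rewrite big_cons big1_seq ?addr0; last first.
  by move=> k /andP[_ /cs->]; rewrite mul0r.
by move/eqP; rewrite mulf_eq0 (negbTE (lt0r_neq0 (expR_gt0 _))) orbF => /eqP.
Qed.

(** * Sums over the fibers of a function *)

Lemma big_fibers (V : nmodType) (I : finType) (T : eqType) (f : I -> T)
    (s : seq T) (G : I -> V) : uniq s ->
  \sum_(v <- s) \sum_(i | f i == v) G i = \sum_(i | f i \in s) G i.
Proof.
move=> us; rewrite big_seq (exchange_big_dep (fun i => f i \in s)) /=; last first.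
  by move=> v i vs /eqP->.
apply: eq_bigr => i fis; rewrite -big_filter (perm_big [:: f i]) ?big_seq1 //.
apply: uniq_perm; rewrite ?filter_uniq // => v; rewrite mem_filter !inE.
by case: (eqVneq v (f i)) => [->|]; rewrite ?fis ?andbF.
Qed.

Lemma weighted_fibers_eq0 (R : pzSemiRingType) (I : finType) (T : eqType)
    (f : I -> T) (g x : I -> R) :
  (forall i j, f i = f j -> g i = g j) ->
  (forall i, g i != 0 -> \sum_(j | f j == f i) x j = 0) ->
  \sum_i g i * x i = 0.
Proof.
move=> gf x0; set s := undup [seq f i | i <- enum I].
have -> : \sum_i g i * x i = \sum_(i | f i \in s) g i * x i.
  by apply: eq_bigl => i; rewrite mem_undup map_f ?mem_enum.
rewrite -big_fibers ?undup_uniq // big1_seq // => v /andP[_].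
rewrite mem_undup => /mapP[i _ ->].
rewrite (eq_bigr (fun j => g i * x j)) => [|j /eqP/gf-> //].
rewrite -big_distrr /=; case: (eqVneq (g i) 0) => [->|/x0->]; last by rewrite mulr0.
by rewrite mul0r.
Qed.

(** A Vandermonde argument for real exponents: [N] power sums determine the
total weight of each value. When some value is zero, it only contributes to
the power [0], so the exponent [n 0] is set aside at first; this is affordable
because at most [N - 1] positive values remain. *)
Lemma power_sums_fibers_eq0 (R : realType) (N : nat) (n f x : 'I_N -> R) :
  (forall i j : 'I_N, (i < j)%N -> n i < n j) ->
  (forall j, 0 <= f j) ->
  (forall j, 0 < f j) \/ (forall i : 'I_N, i = 0%N :> nat -> n i = 0) ->
  (forall k, \sum_j f j `^ n k * x j = 0) ->
  forall v, \sum_(j | f j == v) x j = 0.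
Proof.
move=> n_incr f_ge0 f_pos sum0.
set s := undup [seq f j | j <- enum 'I_N & 0 < f j].
have us : uniq s by exact: undup_uniq.
have sP j : (f j \in s) = (0 < f j).
  rewrite mem_undup; apply/mapP/idP => [[k]|fj];
    last by exists j => //; rewrite mem_filter fj mem_enum.
  by rewrite mem_filter => /andP[fk _] ->.
have s_gt0 v : v \in s -> 0 < v.
  by rewrite mem_undup => /mapP[k]; rewrite mem_filter => /andP[fk _] ->.
have sz_s : (size s <= #|[pred j | (0 < f j)%R]|)%N.
  by rewrite (leq_trans (size_undup _)) // size_map cardE enumT.
have [z [z_incr le_sz z0]] : exists z, [/\ sorted <%R z, (size s <= size z)%N &
    forall t, t \in z -> \sum_(j | 0 < f j) f j `^ t * x j = 0].
  (* z is the list of all exponents, or of all but n 0 when f vanishes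
     somewhere. *)
  have [/forallP fp|/forallPn[j0 fj0]] := boolP [forall j, 0 < f j].
    exists [seq n k | k <- enum 'I_N]; split.
    - rewrite sorted_map; apply: (@sub_sorted _ (relpre val ltn)) => [i j /n_incr //|].
      by rewrite -sorted_map val_enum_ord iota_ltn_sorted.
    - by rewrite (leq_trans sz_s) // size_map -cardE max_card.
    - move=> _ /mapP[k _ ->]; rewrite -[RHS](sum0 k); apply: eq_bigl => j.
      by rewrite fp.
  have n0 (i : 'I_N) : i = 0%N :> nat -> n i = 0.
    by case: f_pos => [fp|h]; [rewrite fp in fj0|apply: h].
  have fj00 : f j0 = 0 by apply/eqP; rewrite eq_le f_ge0 leNgt fj0.
  exists [seq n k | k <- [seq k : 'I_N <- enum 'I_N | (0 < k)%N]]; split.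
  - rewrite sorted_map sorted_filter //; first by move=> i j k; apply: lt_trans.
    apply: (@sub_sorted _ (relpre val ltn)) => [i j /n_incr //|].
    by rewrite -sorted_map val_enum_ord iota_ltn_sorted.
  - rewrite (leq_trans sz_s) // size_map.
    have N0 : (0 < N)%N by apply: leq_ltn_trans (ltn_ord j0).
    have -> : [seq k : 'I_N <- enum 'I_N | (0 < k)%N] = enum (predC1 (Ordinal N0)).
      by rewrite enumT [RHS]/enum_mem; apply: eq_filter => k; rewrite !inE -lt0n.
    rewrite -cardE cardC1 card_ord -ltnS prednK // -[X in (_ < X)%N]card_ord; apply: proper_card.
    by rewrite properE; apply/andP; split;
      [apply/fintype.subsetP|apply/fintype.subsetPn; exists j0].
  move=> _ /mapP[k + ->]; rewrite mem_filter => /andP[k_gt0 _].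
  have nk0 : 0 < n k.
    have N0 : (0 < N)%N by apply: leq_ltn_trans (ltn_ord k).
    by rewrite -(n0 (Ordinal N0) erefl); apply: n_incr.
  rewrite -[RHS](sum0 k) [RHS](bigID (fun j => 0 < f j)) /= [X in _ + X]big1 ?addr0 // => j fj.
  have -> : f j = 0 by apply/eqP; rewrite eq_le f_ge0 leNgt fj.
  by rewrite powR0 ?mul0r // gt_eqF.
pose c v := \sum_(j | f j == v) x j.
have c0 v : v \in s -> c v = 0.
  move=> vs; have inj_ln : {in s &, injective (@ln R)}.
    by move=> u w /s_gt0 us0 /s_gt0 ws0; apply: ln_inj.
  rewrite -[v]lnK ?posrE ?s_gt0 //.
  apply: (@expsum_eq0 _ (map (@ln R) s) z (c \o expR)) => //; rewrite ?size_map ?map_f //.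
    by rewrite map_inj_in_uniq.
  move=> t tz; rewrite big_map -[RHS](z0 t tz) -(eq_bigl _ _ sP) -big_fibers //.
  rewrite !big_seq; apply: eq_bigr => u us0; rewrite /= lnK ?posrE ?s_gt0 // mulrC big_distrr /=.
  apply: eq_bigr => j /eqP->.
  by rewrite [in RHS]/powR gt_eqF ?s_gt0 // [t * _]mulrC.
move=> v; have [v_gt0|v_lt0|<-] := ltgtP 0 v.
- have [/c0//|vNs] := boolP (v \in s); rewrite big1 // => j /eqP fv.
  by rewrite -fv sP fv v_gt0 in vNs.
- by rewrite big1 // => j /eqP fv; have := f_ge0 j; rewrite fv leNgt v_lt0.
(* The positive values being settled, the power n 0 = 0 leaves only the zero
   value. *)
have [->//|nz] : \sum_(j | f j == 0) x j = 0 \/ exists j, f j = 0.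
  have [/existsP[j /eqP fj]|/existsPn fn] := boolP [exists j, f j == 0]; first by right; exists j.
  by left; rewrite big1 // => j; rewrite (negPf (fn j)).
have [j0 fj0] := nz.
case: f_pos => [fp|n0]; first by have := fp j0; rewrite fj0 ltxx.
have N0 : (0 < N)%N by apply: leq_ltn_trans (ltn_ord j0).
rewrite -[RHS](sum0 (Ordinal N0)) n0 // [RHS](eq_bigr x); last by move=> j _; rewrite powRr0 mul1r.
rewrite [RHS](bigID (fun j => f j \in s)) /= -big_fibers //
  [X in _ = X + _]big1_seq ?add0r; last first.
  by move=> u; apply: c0.
by apply: eq_bigl => j; rewrite sP lt_neqAle f_ge0 andbT negbK eq_sym.
Qed.

(** * Principal minors of symmetric matrices *)

Lemma det_mxsub_bij (R : comPzRingType) (m n : nat) (g : 'I_m -> 'I_n)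
    (B : 'M[R]_n) : bijective g -> \det (mxsub g g B) = \det B.
Proof.
move=> bg; have e : m = n by rewrite -[m]card_ord -[n]card_ord (bij_eq_card bg).
case: _ / e B g bg => B g /bij_inj ig.
have -> : mxsub g g B = row_perm (perm.perm ig) (col_perm (perm.perm ig) B).
  by apply/matrixP => i j; rewrite !mxE !perm.permE.
by rewrite row_permE col_permE !det_mulmx !det_perm mulrCA perm.odd_permV -expr2 sqrr_sign mulr1.
Qed.

Lemma complexify_hermsymmx (R : realType) (N : nat) (A : 'M[R]_N) :
  complexify A \is hermsymmx <-> A^T = A.
Proof.
split=> [/is_hermitianmxP/matrixP hA|symA].
  apply/matrixP => i j; rewrite mxE; have := hA j i.
  by rewrite expr0 scale1r !mxE => e; exact: (congr1 (@complex.Re R) e).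
have S i j : A i j = A j i by rewrite -{1}symA mxE.
apply/is_hermitianmxP/matrixP => i j.
by rewrite expr0 scale1r !mxE [RHS]conjc_real S.
Qed.

(** The indices of a principal minor may be listed in any order, which gives
access to the minors on explicit lists of two or three indices. *)
Lemma PMP_det_ge0 (R : realType) (N k l : nat) (A : 'M[R]_N) (f : 'I_l -> 'I_N) :
  PMP k (complexify A) -> (1 <= l <= k)%N -> injective f -> 0 <= \det (mxsub f f A).
Proof.
move=> pmp lk injf; set I := f @: [set: 'I_l]%SET.
have cI : #|I| = l by rewrite card_imset // cardsT card_ord.
have fI i : f i \in I by rewrite imset_f.
pose g i := enum_rank_in (fI i) (f i).
have gK i : enum_val (g i) = f i by rewrite enum_rankK_in.
have -> : mxsub f f A = mxsub g g (mxsub (@enum_val _ (mem I)) (@enum_val _ (mem I)) A).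
  by apply/matrixP => i j; rewrite !mxE !gK.
rewrite det_mxsub_bij; last first.
  apply: inj_card_bij; last by rewrite !card_ord cI.
  by move=> i j /(congr1 enum_val); rewrite !gK => /injf.
have := pmp l lk I cI.
have -> : principal_submx (complexify A) I = map_mx (real_complex R)
    (mxsub (@enum_val _ (mem I)) (@enum_val _ (mem I)) A).
  by apply/matrixP => i j; rewrite !mxE.
by rewrite det_map_mx /= lecR.
Qed.

Lemma PMP3_minor2 (R : realType) (N : nat) (A : 'M[R]_N) : PMP 3 (complexify A) ->
  forall i j, i != j -> 0 <= A i i * A j j - A i j * A j i.
Proof.
move=> pmp i j ij; pose f (u : 'I_2) := nth i [:: i; j] u.
have injf : injective f.
  move=> u v /eqP; rewrite nth_uniq //= ?inE ?ij //; by move/eqP/val_inj.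
have := PMP_det_ge0 pmp (isT : (1 <= 2 <= 3)%N) injf.
rewrite (expand_det_row _ 0) !big_ord_recl big_ord0 /cofactor !det_mx11 !mxE /f /= /bump /=.
by rewrite !(mul1r, mulr1, addr0, expr0, expr1, mulN1r, mulrN).
Qed.

Lemma PMP3_minor3 (R : realType) (N : nat) (A : 'M[R]_N) : PMP 3 (complexify A) ->
  forall i j k, uniq [:: i; j; k] ->
  0 <= A i i * (A j j * A k k - A j k * A k j) - A i j * (A j i * A k k - A j k * A k i)
     + A i k * (A j i * A k j - A j j * A k i).
Proof.
move=> pmp i j k ijk; pose f (u : 'I_3) := nth i [:: i; j; k] u.
have injf : injective f by move=> u v /eqP; rewrite nth_uniq // => /eqP/val_inj.
have := PMP_det_ge0 pmp (isT : (1 <= 3 <= 3)%N) injf.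
congr (_ <= _); rewrite (expand_det_row _ 0) !big_ord_recl big_ord0 /cofactor.
rewrite !(expand_det_row _ 0) !big_ord_recl !big_ord0 /cofactor !det_mx11 !mxE /f /= /bump /=.
ring.
Qed.

(** With [a = A i i = A i j = A j j], the principal minor on [i, j, k] is
[- a * (A j k - A i k) ^+ 2]. When [a = 0], the 2 x 2 minors force both rows
to be zero. *)
Lemma PMP3_row_eq (R : realType) (N : nat) (A : 'M[R]_N) :
  A^T = A -> PMP 3 (complexify A) -> (forall i j, 0 <= A i j) ->
  forall i j, A i j = A i i -> A j j = A i i -> row j A = row i A.
Proof.
move=> symA pmp A0 i j Aij Ajj.
have S a b : A a b = A b a by rewrite -{1}symA mxE.
have m2 a b : A a b ^+ 2 <= A a a * A b b.
  have [->|ab] := eqVneq a b; first by rewrite expr2.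
  by rewrite -subr_ge0 expr2 {2}S; apply: PMP3_minor2.
apply/rowP => k; rewrite !mxE.
have [->|ij] := eqVneq j i; first by [].
have [->|jk] := eqVneq k j; first by rewrite Ajj.
have [->|ik] := eqVneq k i; first by rewrite S.
have := A0 i i; rewrite le_eqVlt => /predU1P[Aii|Aii].
  have z a : A a a = 0 -> A a k = 0.
    move=> Aa; apply/eqP; rewrite -sqrf_eq0 eq_le sqr_ge0 andbT.
    by apply: le_trans (m2 a k) _; rewrite Aa mul0r.
  by rewrite !z // Ajj.
have := @PMP3_minor3 _ _ _ pmp i j k.
rewrite /= !inE negb_or [i == j]eq_sym [i == k]eq_sym [j == k]eq_sym ij jk ik => /(_ isT).
rewrite (S j i) (S k j) (S k i) Ajj Aij.
have -> : A i i * (A i i * A k k - A j k * A j k) - A i i * (A i i * A k k - A j k * A i k) +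
   A i k * (A i i * A j k - A i i * A i k) = - (A i i * (A j k - A i k) ^+ 2) by ring.
rewrite oppr_ge0 pmulr_rle0 // => h; apply/eqP; rewrite -subr_eq0 -sqrf_eq0.
by rewrite eq_le h sqr_ge0.
Qed.

(** Induction on decreasing diagonal entry. The relation [e] is either total or
the relation of lying in the same block of a coarser partition; in both cases
[{j | e i j}] is a union of classes of equal rows, among them that of [i]. *)
Lemma row_class_sums_eq0 (R : realType) (N : nat) (A : 'M[R]_N) (e : rel 'I_N)
    (x : 'I_N -> R) :
  A^T = A -> PMP 3 (complexify A) -> (forall i j, 0 <= A i j) ->
  reflexive e -> (forall i j k, row j A = row k A -> e i j = e i k) ->
  (forall i, \sum_(j | e i j && (A i j == A i i)) x j = 0) ->
  forall i, \sum_(j | row j A == row i A) x j = 0.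
Proof.
move=> symA pmp A0 eR eC x0 i.
have S a b : A a b = A b a by rewrite -{1}symA mxE.
have rowE a b k : row a A = row b A -> A k a = A k b.
  by move=> /rowP/(_ k); rewrite !mxE S => ->; rewrite S.
have [m] := ubnP #|[pred j | (A i i < A j j)%R]|.
elim: m i => // m IH i; rewrite ltnS => le_m.
rewrite -[RHS](x0 i) [RHS](bigID (fun j => row j A == row i A)) /=.
(* The first part of the level set is the class of i; the second one consists
   of classes with larger diagonal entry. *)
rewrite [X in _ = _ + X](_ : _ = 0) ?addr0.
  apply: eq_bigl => j; case: (eqVneq (row j A) (row i A)) => [ji|]; last by rewrite andbF.
  by rewrite andbT (eC i j i ji) eR (rowE _ _ i ji) eqxx.
pose P j := e i j && (A i j == A i i) && (row j A != row i A).
have -> : \sum_(j | P j) x j = \sum_j (P j)%:R * x j.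
  by rewrite big_mkcond; apply: eq_bigr => j _; case: (P j); rewrite ?mul1r ?mul0r.
apply: (weighted_fibers_eq0 (f := fun j => row j A)) => [j k jk|j].
  by rewrite /P (eC i j k jk) (rowE _ _ i jk) jk.
rewrite pnatr_eq0 eqb0 negbK => /andP[/andP[_ /eqP Aij] nij].
have lt_ij : A i i < A j j.
  have ij : i != j by apply: contraNneq nij => ->.
  have := @PMP3_minor2 _ _ _ pmp i j ij; rewrite (S j i) Aij -mulrBr => m2.
  rewrite lt_neqAle; apply/andP; split.
    by apply: contraNneq nij => Ajj; apply/eqP; apply: PMP3_row_eq.
  have /predU1P[<-//|Aii] : (0 == A i i) || (0 < A i i) by rewrite -le_eqVlt.
  by move: m2; rewrite pmulr_rge0 // subr_ge0.
apply: IH; apply: leq_trans le_m; apply: proper_card.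
rewrite properE; apply/andP; split.
  by apply/fintype.subsetP => k; rewrite !inE; apply: lt_trans.
by apply/fintype.subsetPn; exists j; rewrite !inE ?ltxx.
Qed.

(** By symmetry the partition of the indices into classes of equal rows makes
[A] constant on products of blocks, so it refines the coarsest such
partition; conversely, constancy on its blocks makes the rows of a block equal. *)
Lemma pi1_row_class (R : realType) (N : nat) (A : 'M[R]_N) (P : {set {set 'I_N}}) :
  A^T = A -> is_pi1 A P ->
  forall i j, [exists I in P, (i \in I) && (j \in I)] = (row j A == row i A).
Proof.
move=> symA [pP cP mP] i j; apply/exists_inP/eqP => [[I IP /andP[iI jI]]|ji].
  apply/rowP => k; rewrite !mxE.
  have kP : k \in finset.cover P by rewrite (finset.cover_partition pP) inE.
  by apply: (cP I (finset.pblock P k)); rewrite ?pblock_mem ?mem_pblock.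
pose Q := preim_partition (fun i => row i A) [set: 'I_N]%SET.
have pQ : finset.partition Q [set: 'I_N]%SET by apply: preim_partitionP.
have eqr : {in [set: 'I_N]%SET & &, equivalence_rel (fun i j => row i A == row j A)}.
  by split=> // /eqP->.
have /and3P[_ tQ _] := pQ.
have blk I a b : I \in Q -> a \in I -> b \in I -> row a A = row b A.
  move=> IQ aI bI; apply/eqP; rewrite -(pblock_equivalence_partition eqr) ?inE //.
  by rewrite -[equivalence_partition _ _]/Q (def_pblock tQ IQ aI).
have iQ : i \in finset.cover Q by rewrite (finset.cover_partition pQ) inE.
have cQ : block_constant A Q.
  move=> I J IQ JQ a a' b b' aI a'I bJ b'J.
  have /rowP/(_ b) := blk _ _ _ IQ aI a'I; rewrite !mxE => ->.
  have /rowP/(_ a') := blk _ _ _ JQ bJ b'J; rewrite !mxE.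
  by rewrite -{1 2}symA !mxE.
have [J JP /fintype.subsetP sJ] := mP _ pQ cQ _ (pblock_mem iQ).
exists J => //; rewrite !sJ ?mem_pblock //.
by rewrite (pblock_equivalence_partition eqr) ?inE // ji.
Qed.

(** * The four kernels *)

Definition annihilates (R : pzSemiRingType) (N : nat) (B : 'M[R]_N) (v : 'I_N -> R) : Prop :=
  forall i, \sum_j B i j * v j = 0.

Lemma kernelP (R : realType) (N : nat) (B : 'M[R]_N) (x : 'cV[R[i]]_N) :
  Defs.kernel B x <-> annihilates B (fun j => complex.Re (x j ord0)) /\
                      annihilates B (fun j => complex.Im (x j ord0)).
Proof.
have E i : (complexify B *m x) i ord0 =
    ((\sum_j B i j * complex.Re (x j ord0)) +i* (\sum_j B i j * complex.Im (x j ord0)))%C.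
  rewrite mxE; elim/big_rec3: _ => [//|j re im z _ ->]; rewrite mxE.
  by case: (x j ord0) => a b; congr Complex => /=; rewrite ?mul0r ?subr0 ?addr0.
split=> [/matrixP Bx|[re im]].
  by split=> i; have := Bx i ord0; rewrite E mxE => -[].
by apply/matrixP => i j; rewrite ord1 E re im mxE.
Qed.

(** A common form of the entrywise powers ([e] total) and of their block-diagonal
parts ([e] the relation of lying in the same block). *)
Definition masked_power (R : realType) (N : nat) (e : rel 'I_N) (A : 'M[R]_N) (a : R) :
  'M[R]_N := \matrix_(i, j) if e i j then A i j `^ a else 0.

Lemma annihilates_JmxP (R : realType) (N : nat) (A : 'M[R]_N) (P : {set {set 'I_N}}) :
  A^T = A -> is_pi1 A P ->
  forall v, annihilates (Jmx R P) v <->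
            forall i, \sum_(j | row j A == row i A) v j = 0.
Proof.
move=> symA pi1 v.
have E i : \sum_j Jmx R P i j * v j = \sum_(j | row j A == row i A) v j.
  rewrite [RHS]big_mkcond; apply: eq_bigr => j _; rewrite !mxE (pi1_row_class symA pi1).
  by case: ifP; rewrite ?mul1r ?mul0r.
by split=> h i; have := h i; rewrite E.
Qed.

Lemma masked_powers_annihilates_class_sums (R : realType) (N : nat) (A : 'M[R]_N)
    (e : rel 'I_N) (n v : 'I_N -> R) :
  A^T = A -> PMP 3 (complexify A) -> (forall i j, 0 <= A i j) ->
  (forall i j, 0 < A i j) \/ (forall i : 'I_N, i = 0%N :> nat -> n i = 0) ->
  (forall i j : 'I_N, (i < j)%N -> n i < n j) ->
  reflexive e -> (forall i j k, row j A = row k A -> e i j = e i k) ->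
  (forall k, annihilates (masked_power e A (n k)) v) ->
  forall i, \sum_(j | row j A == row i A) v j = 0.
Proof.
move=> symA pmp A0 Apos n_incr eR eC v0.
apply: (row_class_sums_eq0 symA pmp A0 eR eC) => i.
pose w j := if e i j then v j else 0.
rewrite -[RHS](_ : \sum_(j | A i j == A i i) w j = 0); last first.
  apply: (power_sums_fibers_eq0 n_incr (A0 i)) => [|k].
    by case: Apos => [Ap|n0]; [left=> j; apply: Ap|right].
  rewrite -[RHS](v0 k i); apply: eq_bigr => j _; rewrite mxE /w.
  by case: ifP; rewrite ?mulr0 ?mul0r.
by rewrite -big_mkcondl.
Qed.

Lemma class_sums_masked_power (R : realType) (N : nat) (A : 'M[R]_N)
    (e : rel 'I_N) (v : 'I_N -> R) (a : R) :
  A^T = A -> (forall i j k, row j A = row k A -> e i j = e i k) ->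
  (forall i, \sum_(j | row j A == row i A) v j = 0) ->
  annihilates (masked_power e A a) v.
Proof.
move=> symA eC v0 i; apply: (weighted_fibers_eq0 (f := fun j => row j A)) => [j k jk|j _].
  rewrite !mxE (eC i j k jk); have /rowP/(_ i) := jk.
  by rewrite !mxE => jki; rewrite -symA !mxE jki.
exact: v0.
Qed.

Lemma four_kernels_of_PMP3 (R : realType) (D : set R) (N : nat) (A : 'M[R]_N)
    (P P' : {set {set 'I_N}}) (n : 'I_N -> R) :
  A^T = A -> PMP 3 (complexify A) -> (forall i j, 0 <= A i j) ->
  (forall i j, 0 < A i j) \/ (forall i : 'I_N, i = 0%N :> nat -> n i = 0) ->
  is_pi1 A P -> finset.partition P' [set: 'I_N]%SET -> refines P P' ->
  (forall i j : 'I_N, (i < j)%N -> n i < n j) -> (forall k, D (n k)) ->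
  four_kernels_equal D A n P P'.
Proof.
move=> symA pmp A0 Apos pi1 pP' PP' n_incr Dn.
pose e1 : rel 'I_N := fun _ _ => true.
pose e2 : rel 'I_N := fun i j => [exists I in P', (i \in I) && (j \in I)].
have e2C i j k : row j A = row k A -> e2 i j = e2 i k.
  have imp a b : row a A = row b A -> e2 i a -> e2 i b.
    move=> ab /exists_inP[I IP' /andP[iI aI]].
    have : [exists I in P, (b \in I) && (a \in I)] by rewrite (pi1_row_class symA pi1) ab.
    move=> /exists_inP[J /PP'[K KP' /fintype.subsetP JK] /andP[/JK bK /JK aK]].
    have /and3P[_ tP' _] := pP'.
    apply/exists_inP; exists I => //; rewrite iI.
    by rewrite -(def_pblock tP' IP' aI) (def_pblock tP' KP' aK) bK.
  by move=> jk; apply/idP/idP; apply: imp.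
have e2R : reflexive e2.
  move=> i; have iP' : i \in finset.cover P' by rewrite (finset.cover_partition pP') inE.
  by apply/exists_inP; exists (finset.pblock P' i); rewrite ?pblock_mem ?mem_pblock ?iP'.
have E1 a : hadamard_pow A a = masked_power e1 A a.
  by apply/matrixP => i j; rewrite !mxE.
have E2 a : block_diag P' (hadamard_pow A a) = masked_power e2 A a.
  by apply/matrixP => i j; rewrite !mxE.
have toJ e : reflexive e -> (forall i j k, row j A = row k A -> e i j = e i k) ->
    forall x, (forall k, Defs.kernel (masked_power e A (n k)) x) -> Defs.kernel (Jmx R P) x.
  move=> eR eC x kx; apply/kernelP; split; apply/(annihilates_JmxP symA pi1);
    apply: (masked_powers_annihilates_class_sums symA pmp A0 Apos n_incr eR eC) => k;
    by have /kernelP[] := kx k.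
have fromJ e : (forall i j k, row j A = row k A -> e i j = e i k) ->
    forall x a, Defs.kernel (Jmx R P) x -> Defs.kernel (masked_power e A a) x.
  move=> eC x a /kernelP[/(annihilates_JmxP symA pi1) re /(annihilates_JmxP symA pi1) im].
  by apply/kernelP; split; apply: class_sums_masked_power.
have K1 : ker_powers A n = Defs.kernel (Jmx R P).
  apply/seteqP; split=> x.
    by move=> kx; apply: (toJ e1) => // k; rewrite -E1; apply: kx.
  by move=> Jx k _; rewrite /= E1; apply: fromJ.
have K2 : ker_all_powers D A = Defs.kernel (Jmx R P).
  apply/seteqP; split=> x.
    by move=> kx; apply: (toJ e1) => // k; rewrite -E1; apply: kx.
  by move=> Jx k _; rewrite /= E1; apply: fromJ.
have K3 : ker_block_powers D A P' = Defs.kernel (Jmx R P).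
  apply/seteqP; split=> x.
    by move=> kx; apply: (toJ e2) => // k; rewrite -E2; apply: kx.
  by move=> Jx k _; rewrite /= E2; apply: fromJ.
by split; rewrite ?K1 ?K2 ?K3.
Qed.

(** * A counterexample without the minor condition *)

(** Each row has one [true] entry and one [false] entry in columns 0 and 1, and
likewise in columns 2 and 3. *)
Definition cex_pattern (i j : nat) : bool :=
  nth false (nth [::] [:: [:: true;  false; false; true];
                          [:: false; true;  true;  false];
                          [:: false; true;  false; true];
                          [:: true;  false; true;  false]] i) j.

Definition cex_mx (R : realType) (u w : R) : 'M[R]_4 :=
  \matrix_(i, j) if cex_pattern i j then u else w.

Lemma cex_mx_sym (R : realType) (u w : R) : (cex_mx u w)^T = cex_mx u w.
Proof.
apply/matrixP => -[i i4] [j j4]; rewrite !mxE /=.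
by move: i i4 j j4; do 4?[case=> [|]] => // _; do 4?[case=> [|]].
Qed.

Lemma cex_four_kernels_neq (R : realType) (u w : R) (D : set R) (n : 'I_4 -> R)
    (P P' : {set {set 'I_4}}) :
  u != w -> is_pi1 (cex_mx u w) P -> ~ four_kernels_equal D (cex_mx u w) n P P'.
Proof.
move=> uw pi1 [_ K23 K34].
pose x : 'cV[R[i]]_4 := \col_j (nth 0 [:: 1; 1; -1; -1] j).
have xJ : Defs.kernel (Jmx R P) x.
  rewrite -K34 -K23 => a _; apply/matrixP => i j; rewrite !mxE.
  rewrite !big_ord_recl big_ord0 !mxE /= /bump /=.
  by case: i => [] [|[|[|[|]]]] //= _; ring.
have /kernelP[+ _] := xJ => /(annihilates_JmxP (cex_mx_sym u w) pi1)/(_ ord0).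
rewrite (big_pred1 ord0) => [|j]; first by rewrite !mxE => /eqP; rewrite oner_eq0.
apply/eqP/eqP => [/rowP r|->//]; apply/eqP; rewrite -[_ == _]negbK; apply/negP => j0.
(* Row 0 differs from rows 1 and 2 in column 0, from row 3 in column 4 and
   from row 4 in column 2. *)
have := r ord0; have := r (inord 2); rewrite !mxE !inordK //=.
move: uw j0; rewrite eq_sym => /eqP wu.
by case: j {r} => [] [|[|[|[|]]]] //= _ _; do ?[move=> /wu // | move=> /esym/wu // | move=> _].
Qed.

Lemma cex_pi1_exists (R : realType) (u w : R) : exists P,
  [/\ is_pi1 (cex_mx u w) P, finset.partition P [set: 'I_4]%SET & refines P P].
Proof.
have [P pi1] := is_pi1_exists (cex_mx u w); exists P; split=> //; first by case: pi1.
by move=> I IP; exists I.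
Qed.

(** * The equality of the four kernels and its failure *)

Theorem proposition3p3 (R : realType) :
  [/\ (forall (N : nat) (A : 'M[R]_N) (pi pi' : {set {set 'I_N}})
          (n : 'I_N -> R),
        complexify A \is hermsymmx ->
        PMP 3 (complexify A) ->
        (forall i j, 0 < A i j) ->
        is_pi1 A pi ->
        finset.partition pi' [set: 'I_N]%SET ->
        refines pi pi' ->
        (forall i j : 'I_N, (i < j)%N -> n i < n j) ->
        four_kernels_equal [set: R] A n pi pi'),
      (forall (N : nat) (A : 'M[R]_N) (pi pi' : {set {set 'I_N}})
          (n : 'I_N -> R),
        complexify A \is hermsymmx ->
        PMP 3 (complexify A) ->
        (forall i j, 0 <= A i j) ->
        (exists i j, A i j = 0) ->
        is_pi1 A pi ->
        finset.partition pi' [set: 'I_N]%SET ->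
        refines pi pi' ->
        (forall i j : 'I_N, (i < j)%N -> n i < n j) ->
        (forall i : 'I_N, i = 0%N :> nat -> n i = 0) ->
        four_kernels_equal [set a : R | 0 <= a] A n pi pi'),
      (exists (N : nat) (A : 'M[R]_N) (pi pi' : {set {set 'I_N}})
          (n : 'I_N -> R),
        complexify A \is hermsymmx /\
        ~ PMP 3 (complexify A) /\
        (forall i j, 0 < A i j) /\
        is_pi1 A pi /\
        finset.partition pi' [set: 'I_N]%SET /\
        refines pi pi' /\
        (forall i j : 'I_N, (i < j)%N -> n i < n j) /\
        ~ four_kernels_equal [set: R] A n pi pi')
    & (exists (N : nat) (A : 'M[R]_N) (pi pi' : {set {set 'I_N}})
          (n : 'I_N -> R),
        complexify A \is hermsymmx /\
        ~ PMP 3 (complexify A) /\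
        (forall i j, 0 <= A i j) /\
        (exists i j, A i j = 0) /\
        is_pi1 A pi /\
        finset.partition pi' [set: 'I_N]%SET /\
        refines pi pi' /\
        (forall i j : 'I_N, (i < j)%N -> n i < n j) /\
        (forall i : 'I_N, i = 0%N :> nat -> n i = 0) /\
        ~ four_kernels_equal [set a : R | 0 <= a] A n pi pi')].
Proof.
have pos (N : nat) (A : 'M[R]_N) (pi pi' : {set {set 'I_N}}) (n : 'I_N -> R) :
    complexify A \is hermsymmx -> PMP 3 (complexify A) -> (forall i j, 0 < A i j) ->
    is_pi1 A pi -> finset.partition pi' [set: 'I_N]%SET -> refines pi pi' ->
    (forall i j : 'I_N, (i < j)%N -> n i < n j) ->
    four_kernels_equal [set: R] A n pi pi'.
  move=> /complexify_hermsymmx symA pmp Apos pi1 pP' ref n_incr.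
  by apply: four_kernels_of_PMP3 => //; [move=> i j; apply: ltW|left].
have nneg (N : nat) (A : 'M[R]_N) (pi pi' : {set {set 'I_N}}) (n : 'I_N -> R) :
    complexify A \is hermsymmx -> PMP 3 (complexify A) -> (forall i j, 0 <= A i j) ->
    is_pi1 A pi -> finset.partition pi' [set: 'I_N]%SET -> refines pi pi' ->
    (forall i j : 'I_N, (i < j)%N -> n i < n j) ->
    (forall i : 'I_N, i = 0%N :> nat -> n i = 0) ->
    four_kernels_equal [set a : R | 0 <= a] A n pi pi'.
  move=> /complexify_hermsymmx symA pmp A0 pi1 pP' ref n_incr n0.
  apply: four_kernels_of_PMP3 => //; first by right.
  move=> k /=; have N0 : (0 < N)%N by apply: leq_ltn_trans (ltn_ord k).
  have [k0|k0] := posnP k; first by rewrite n0.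
  by rewrite -(n0 (Ordinal N0) erefl); apply/ltW/n_incr.
pose n (k : 'I_4) : R := k%:R.
have n_incr (i j : 'I_4) : (i < j)%N -> n i < n j by rewrite ltr_nat.
have n0 (i : 'I_4) : i = 0%N :> nat -> n i = 0 by rewrite /n => ->.
split.
- exact: pos.
- by move=> N A pi pi' n' herm pmp A0 _; apply: nneg.
- have [P [pi1 pP rP]] := cex_pi1_exists (1 : R) 2%:R.
  have Apos i j : 0 < cex_mx (1 : R) 2%:R i j by rewrite mxE; case: ifP.
  have herm := (complexify_hermsymmx _).2 (cex_mx_sym (1 : R) 2%:R).
  have neq : ~ four_kernels_equal [set: R] (cex_mx (1 : R) 2%:R) n P P.
    by apply: cex_four_kernels_neq pi1; rewrite lt_eqF ?ltr1n.
  exists 4%N, (cex_mx 1 2%:R), P, P, n; do !split=> //.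
  by move=> pmp; apply: neq; apply: pos.
- have [P [pi1 pP rP]] := cex_pi1_exists (1 : R) 0.
  have A0 i j : 0 <= cex_mx (1 : R) 0 i j by rewrite mxE; case: ifP.
  have herm := (complexify_hermsymmx _).2 (cex_mx_sym (1 : R) 0).
  have neq : ~ four_kernels_equal [set a : R | 0 <= a] (cex_mx (1 : R) 0) n P P.
    by apply: cex_four_kernels_neq pi1; rewrite oner_eq0.
  exists 4%N, (cex_mx 1 0), P, P, n; do !split=> //.
    by move=> pmp; apply: neq; apply: nneg.
  by exists ord0, (lift ord0 ord0); rewrite mxE.
Qed.
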